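(* Let $A\in\mathbb{R}^{m\times n}$ ($m\ll n$), let $k$ be a positive integer, and let $y:=Ax+\eta$, where $x\in\mathbb{R}^n$ is $k$-compressible, $\eta\in\mathbb{R}^m$ and $S=\mathcal{L}_k(x)$. Let $q\ge k$ be a positive integer and let $\varphi=\frac{\sqrt5+1}{2}$. Suppose that the restricted isometry constants of $A$ satisfy $\delta_{\max\{q,3k\}}<\beta^*$, where $\beta^*$ is the unique real root in $(0,1)$ of $$9\varphi^2\left[\lceil\tfrac nk\rceil\beta^5+\left(\lceil\tfrac nk\rceil+4\sqrt{\lceil\tfrac nk\rceil}\right)\beta^4+4\left(\sqrt{\lceil\tfrac nk\rceil}+1\right)\beta^3+4\beta^2\right]+\beta-1=0.$$ Let $\lambda$ be chosen such that $$(1+\delta_q)\left(1-\frac{\frac1{3\varphi}\sqrt{\frac{1-\delta_{2k}}{1+\delta_k}}-\delta_{3k}}{1+\sqrt{\lceil\frac nk\rceil}\,\delta_{3k}}\right)<\lambda<(1-\delta_q)\left(1+\frac{\frac1{3\varphi}\sqrt{\frac{1-\delta_{2k}}{1+\delta_k}}-\delta_{3k}}{1+\sqrt{\lceil\frac nk\rceil}\,\delta_{3k}}\right),$$ and let the parameters $\alpha,\gamma>0$ satisfy $\frac1{1+\delta_q}\le\alpha\gamma\le\frac1{1-\delta_q}$. Then the sequence $\{x^{(p)}\}$ generated by the CNOT algorithm (with input $A,y,k,q,\lambda,\alpha,\gamma$) satisfies, for every $p\ge0$, $$\|x^{(p+1)}-x_S\|_2\le\rho_3\|x^{(p)}-x_S\|_2+\tau_3\|\eta'\|_2,$$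 where $\eta'=Ax_{\overline S}+\eta$, $$\rho_3:=3\varphi\sqrt{\frac{1+\delta_k}{1-\delta_{2k}}}\left(\delta_{3k}+\Delta(\lambda,\delta_q)\left(1+\sqrt{\lceil\tfrac nk\rceil}\,\delta_{3k}\right)\right),$$ $$\tau_3:=\frac{3\lambda\varphi(1+\delta_k)\sqrt{\lceil\frac nk\rceil}}{(1-\delta_q)\sqrt{1-\delta_{2k}}}+\frac{2\varphi}{\sqrt{1-\delta_{2k}}},\qquad \Delta(\lambda,\delta_q):=\max\left\{\left|1-\tfrac{\lambda}{1-\delta_q}\right|,\left|1-\tfrac{\lambda}{1+\delta_q}\right|\right\},$$ and $\rho_3<1$. Moreover, $\{x^{(p)}\}$ converges to $x_S$ when $\eta'=0$.
   Context: Restricted isometry constant: for a positive integer $t$, $\delta_t$ is the smallest $\delta\in[0,1)$ such that $(1-\delta)\|z\|_2^2\le\|Az\|_2^2\le(1+\delta)\|z\|_2^2$ for all $t$-sparse $z\in\mathbb{R}^n$ (vectors with at most $t$ nonzero entries); a bound on $\delta_t$ includes the requirement that such a constant exists. Note that $\delta_t$ is nondecreasing in $t$. Notation: $\mathcal{H}_k(z)$ keeps the $k$ largest-magnitude entries of $z$ and sets the others to zero (ties broken by any fixed rule); $\mathcal{L}_k(z)$ is the support of $\mathcal{H}_k(z)$. For an index set $\Omega\subseteq\{1,\dots,n\}$, $\overline\Omega$ is its complement, $A_\Omega$ is the submatrix of columns of $A$ indexed by $\Omega$, and for a vector $x$, $x_\Omega\in\mathbb{R}^n$ (used as an argument of $A$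 or compared with vectors in $\mathbb{R}^n$) equals $x$ on $\Omega$ and is zero elsewhere. Thus $x_S$ is the best $k$-term approximation of $x$. ''$k$-compressible'' is an informal term (well approximated by a $k$-sparse vector, not necessarily exactly $k$-sparse) and imposes no quantitative condition on $x$. $\mathbf e$ is the all-ones vector, $\otimes$ is the entrywise (Hadamard) product of vectors, and vector inequalities are entrywise. For $\Omega\subseteq\{1,\dots,n\}$ and parameters $\alpha,\gamma>0$: $M(\Omega)\in\mathbb{R}^{n\times n}$ is the matrix with principal submatrix $M(\Omega)_{\Omega\times\Omega}=(A_\Omega^\top A_\Omega)^{-1}$, diagonal entries $[M(\Omega)]_{ii}=\alpha$ for $i\notin\Omega$, and all other entries zero; $Z(\Omega)=\operatorname{diag}(z_1,\dots,z_n)$ with $z_i=1$ for $i\in\Omega$ and $z_i=\gamma$ for $i\notin\Omega$. CNOT algorithm (compressed Newton-direction-based optimal thresholding): start from $x^{(0)}=\mathbf 0$. For $p=0,1,2,\dots$: let $\Omega^p=\mathcal{L}_q(A^\top(y-Ax^{(p)}))$, set $u^{(p)}=x^{(p)}+\lambda M(\Omega^p)Z(\Omega^p)A^\top(y-Ax^{(p)})$, let $w^{(p)}$ be a minimizer of $\|y-A(w\otimes u^{(p)})\|_2^2$ over $\{w\in\mathbb{R}^n:\mathbf e^\top w=k,\ \mathbf 0\le w\le\mathbf e\}$, and set $x^{(p+1)}=\mathcal{H}_k(w^{(p)}\otimes u^{(p)})$. *)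

(* Defs.v *)
From HB Require Import structures.
From mathcomp Require Import all_boot all_order all_algebra.
From mathcomp Require Import all_classical all_reals all_analysis.

Set Implicit Arguments.
Unset Strict Implicit.
Unset Printing Implicit Defensive.

Import Order.TTheory GRing.Theory Num.Theory.
Import numFieldNormedType.Exports.

Local Open Scope classical_set_scope.
Local Open Scope ring_scope.

Section CNOT.
Context {R : realType}.

(* The norm that the library puts on matrices is the sup norm. *)
Definition l2norm {n} (v : 'cV[R]_n) : R := Num.sqrt (\sum_i v i 0 ^+ 2).

Definition supp {n} (v : 'cV[R]_n) : {set 'I_n} := [set i | v i 0 != 0]%SET.

Definition restr {n} (W : {set 'I_n}) (v : 'cV[R]_n) : 'cV[R]_n :=
  \col_i (if i \in W then v i 0 else 0).

Definition hadamard {n} (u v : 'cV[R]_n) : 'cV[R]_n := map2_mx *%R u v.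

Definition rip {m n} (A : 'M[R]_(m, n)) (t : nat) (d : R) : Prop :=
  forall z : 'cV[R]_n, (#|supp z| <= t)%N ->
    (1 - d) * l2norm z ^+ 2 <= l2norm (A *m z) ^+ 2 <= (1 + d) * l2norm z ^+ 2.

Definition is_ric {m n} (A : 'M[R]_(m, n)) (t : nat) (d : R) : Prop :=
  [/\ 0 <= d < 1, rip A t d &
      forall d', 0 <= d' < 1 -> rip A t d' -> d <= d'].

Definition has_ric {m n} (A : 'M[R]_(m, n)) (t : nat) : Prop :=
  exists d, is_ric A t d.

(* Meaningful only under [has_ric A t]; the value is then unique. *)
Definition ric {m n} (A : 'M[R]_(m, n)) (t : nat) : R :=
  xget 0 [set d | is_ric A t d].

(* A tie-breaking rule: [T t z] is a set of [t] indices (all of them when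
   [n < t]) that carries the [t] largest magnitudes of [z]. *)
Definition top_rule {n} (T : nat -> 'cV[R]_n -> {set 'I_n}) : Prop :=
  forall t z, #|T t z| = minn t n /\
    forall i j, i \in T t z -> j \notin T t z -> `|z j 0| <= `|z i 0|.

Definition hard_thr {n} (T : nat -> 'cV[R]_n -> {set 'I_n}) t (z : 'cV[R]_n) :
    'cV[R]_n :=
  restr (T t z) z.

(* Has fewer than [t] elements when [z] has fewer than [t] nonzero entries. *)
Definition top_supp {n} (T : nat -> 'cV[R]_n -> {set 'I_n}) t (z : 'cV[R]_n) :
    {set 'I_n} :=
  supp (hard_thr T t z).

Definition colsel {m n} (W : {set 'I_n}) (A : 'M[R]_(m, n)) : 'M[R]_(m, #|W|) :=
  colsub (@enum_val _ (mem W)) A.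

(* [colsel W 1%:M] embeds R^W into R^n, so that the first summand is the
   inverse Gram matrix placed in the W x W block and zero elsewhere. *)
Definition newtonM {m n} (A : 'M[R]_(m, n)) (alpha : R) (W : {set 'I_n}) :
    'M[R]_n :=
  let E : 'M[R]_(n, #|W|) := colsel W 1%:M in
  let AW := colsel W A in
  E *m invmx (AW^T *m AW) *m E^T
  + diag_mx (\row_i (if i \in W then 0 else alpha)).

Definition scaleZ {n} (gamma : R) (W : {set 'I_n}) : 'M[R]_n :=
  diag_mx (\row_i (if i \in W then 1 else gamma)).

Definition relaxed_weight {n} (k : nat) (w : 'cV[R]_n) : Prop :=
  \sum_i w i 0 = k%:R /\ forall i, 0 <= w i 0 <= 1.

Definition is_opt_weight {m n} (A : 'M[R]_(m, n)) (y : 'cV[R]_m) (k : nat)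
    (u w : 'cV[R]_n) : Prop :=
  relaxed_weight k w /\
  forall w', relaxed_weight k w' ->
    l2norm (y - A *m hadamard w u) ^+ 2 <= l2norm (y - A *m hadamard w' u) ^+ 2.

Definition newton_step {m n} (T : nat -> 'cV[R]_n -> {set 'I_n})
    (A : 'M[R]_(m, n)) (y : 'cV[R]_m) (q : nat) (lambda alpha gamma : R)
    (v : 'cV[R]_n) : 'cV[R]_n :=
  let g := A^T *m (y - A *m v) in
  let W := top_supp T q g in
  v + lambda *: (newtonM A alpha W *m scaleZ gamma W *m g).

(* A relation, since the minimizer [w] need not be unique. *)
Definition CNOT {m n} (T : nat -> 'cV[R]_n -> {set 'I_n})
    (A : 'M[R]_(m, n)) (y : 'cV[R]_m) (k q : nat) (lambda alpha gamma : R)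
    (xs : nat -> 'cV[R]_n) : Prop :=
  xs 0%N = 0 /\
  forall p, let u := newton_step T A y q lambda alpha gamma (xs p) in
    exists w, is_opt_weight A y k u w /\ xs p.+1 = hard_thr T k (hadamard w u).

Definition golden : R := (Num.sqrt 5 + 1) / 2.

Definition ceil_div (n k : nat) : R := (Num.ceil (n%:R / k%:R : R))%:~R.

Definition beta_root (n k : nat) (b : R) : Prop :=
  let N := ceil_div n k in
  0 < b < 1 /\
  9 * golden ^+ 2 * (N * b ^+ 5 + (N + 4 * Num.sqrt N) * b ^+ 4
                     + 4 * (Num.sqrt N + 1) * b ^+ 3 + 4 * b ^+ 2) + b - 1 = 0.

Definition DeltaL (lambda d : R) : R :=
  Num.max `|1 - lambda / (1 - d)| `|1 - lambda / (1 + d)|.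

Definition lambda_radius {m n} (A : 'M[R]_(m, n)) (k : nat) : R :=
  ((3 * golden)^-1 * Num.sqrt ((1 - ric A (2 * k)) / (1 + ric A k))
     - ric A (3 * k))
  / (1 + Num.sqrt (ceil_div n k) * ric A (3 * k)).

Definition rho3 {m n} (A : 'M[R]_(m, n)) (k q : nat) (lambda : R) : R :=
  3 * golden * Num.sqrt ((1 + ric A k) / (1 - ric A (2 * k)))
  * (ric A (3 * k)
     + DeltaL lambda (ric A q)
       * (1 + Num.sqrt (ceil_div n k) * ric A (3 * k))).

Definition tau3 {m n} (A : 'M[R]_(m, n)) (k q : nat) (lambda : R) : R :=
  3 * lambda * golden * (1 + ric A k) * Num.sqrt (ceil_div n k)
    / ((1 - ric A q) * Num.sqrt (1 - ric A (2 * k)))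
  + 2 * golden / Num.sqrt (1 - ric A (2 * k)).

End CNOT.

(* Main.v *)
Require Import Defs.
From HB Require Import structures.
From mathcomp Require Import all_boot all_order all_algebra.
From mathcomp Require Import all_classical all_reals all_analysis.
From mathcomp Require Import ring lra.

Set Implicit Arguments.
Unset Strict Implicit.
Unset Printing Implicit Defensive.

Import Order.TTheory GRing.Theory Num.Theory.
Import numFieldNormedType.Exports.

Local Open Scope classical_set_scope.
Local Open Scope ring_scope.

(* Write v for the current iterate, a = v - x_S and B = M(W) Z(W). Then
     u - x_S = (a - A^T A a) + (I - lambda B) A^T A a + lambda B A^T eta'.
   On k indices the first term is at most delta_3k |a|, because a is 2k-sparse.
   The eigenvalues of B lie in [1/(1+delta_q), 1/(1-delta_q)], so I - lambda B
   has norm at most Delta(lambda, delta_q), and cutting {1..n} into ceil(n/k)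
   blocks turns estimates on k indices into estimates of the full norm.
   Optimality of w against the indicator of a k-set containing S, together with
   the fact that w is a convex combination of indicators of k-sets, bounds
   w * u - x_S on 2k indices; this gives the constant 2 where the theorem
   allows 3. Hard thresholding costs the golden ratio. The window for lambda is
   exactly what makes Delta small enough for rho_3 < 1; the root beta only
   guarantees that this window is nonempty. *)

(** * Inner product and restriction *)

Section Dot.
Context {R : realType}.
Implicit Types (n : nat).

Definition dot {n} (u v : 'cV[R]_n) : R := \sum_i u i 0 * v i 0.

Lemma dotC n (u v : 'cV[R]_n) : dot u v = dot v u.
Proof. by apply: eq_bigr => i _; rewrite mulrC. Qed.

Lemma dotDl n (u v w : 'cV[R]_n) : dot (u + v) w = dot u w + dot v w.
Proof. by rewrite -big_split; apply: eq_bigr => i _; rewrite mxE mulrDl. Qed.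

Lemma dotZl n a (u w : 'cV[R]_n) : dot (a *: u) w = a * dot u w.
Proof. by rewrite /dot mulr_sumr; apply: eq_bigr => i _; rewrite mxE mulrA. Qed.

Lemma dotNl n (u w : 'cV[R]_n) : dot (- u) w = - dot u w.
Proof. by rewrite -scaleN1r dotZl mulN1r. Qed.

Lemma dotDr n (u v w : 'cV[R]_n) : dot w (u + v) = dot w u + dot w v.
Proof. by rewrite dotC dotDl !(dotC w). Qed.

Lemma dotZr n a (u w : 'cV[R]_n) : dot w (a *: u) = a * dot w u.
Proof. by rewrite dotC dotZl (dotC w). Qed.

Lemma dotNr n (u w : 'cV[R]_n) : dot w (- u) = - dot w u.
Proof. by rewrite dotC dotNl (dotC w). Qed.

Lemma dot0l n (w : 'cV[R]_n) : dot 0 w = 0.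
Proof. by rewrite -(scale0r 0) dotZl mul0r. Qed.

Definition dotE := (dotDl, dotDr, dotNl, dotNr, dotZl, dotZr).

Lemma dot_mulmx m n (A : 'M[R]_(m, n)) u v : dot (A *m u) v = dot u (A^T *m v).
Proof.
have dotM p (a b : 'cV[R]_p) : dot a b = (a^T *m b) 0 0.
  by rewrite mxE; apply: eq_bigr => i _; rewrite mxE.
by rewrite !dotM trmx_mul mulmxA.
Qed.

Lemma dot_ge0 n (v : 'cV[R]_n) : 0 <= dot v v.
Proof. by apply: sumr_ge0 => i _; rewrite -expr2 sqr_ge0. Qed.

Lemma l2norm_ge0 n (v : 'cV[R]_n) : 0 <= l2norm v.
Proof. exact: sqrtr_ge0. Qed.

Lemma l2norm_sqr n (v : 'cV[R]_n) : l2norm v ^+ 2 = dot v v.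
Proof. by rewrite sqr_sqrtr // sumr_ge0 // => i _; rewrite sqr_ge0. Qed.

Lemma l2norm_eq0 n (v : 'cV[R]_n) : l2norm v = 0 -> v = 0.
Proof.
move=> v0; have := l2norm_sqr v; rewrite v0 expr0n /= => /esym/eqP.
rewrite psumr_eq0 => [|i _]; last by rewrite -expr2 sqr_ge0.
move=> /allP h; apply/matrixP => i j; rewrite ord1 mxE.
by have := h i (mem_index_enum i); rewrite mulf_eq0 orbb => /eqP.
Qed.

Lemma l2norm0 n : l2norm (0 : 'cV[R]_n) = 0.
Proof. by apply/eqP; rewrite -sqrf_eq0 l2norm_sqr dot0l. Qed.

Lemma l2normZ n a (v : 'cV[R]_n) : l2norm (a *: v) = `|a| * l2norm v.
Proof.
apply/eqP; rewrite -(@eqrXn2 _ 2) ?mulr_ge0 ?l2norm_ge0 //.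
by rewrite exprMn !l2norm_sqr real_normK ?num_real // !dotE mulrA.
Qed.

Lemma l2normN n (v : 'cV[R]_n) : l2norm (- v) = l2norm v.
Proof. by rewrite -scaleN1r l2normZ normrN1 mul1r. Qed.

Lemma l2normB n (u v : 'cV[R]_n) : l2norm (u - v) = l2norm (v - u).
Proof. by rewrite -opprB l2normN. Qed.

Lemma cauchy_schwarz n (u v : 'cV[R]_n) : dot u v <= l2norm u * l2norm v.
Proof.
have [v0|v0] := eqVneq (l2norm v) 0.
  by rewrite v0 (l2norm_eq0 v0) dotC dot0l mulr0.
have vp : 0 < l2norm v by rewrite lt0r v0 l2norm_ge0.
have [u0|u0] := eqVneq (l2norm u) 0.
  by rewrite u0 (l2norm_eq0 u0) dot0l mul0r.
have up : 0 < l2norm u by rewrite lt0r u0 l2norm_ge0.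
have := dot_ge0 (l2norm v *: u - l2norm u *: v).
rewrite !dotE (dotC v u) -!l2norm_sqr => h.
rewrite -(ler_pM2l (mulr_gt0 up vp)); nra.
Qed.

Lemma l2normD n (u v : 'cV[R]_n) : l2norm (u + v) <= l2norm u + l2norm v.
Proof.
rewrite -ler_sqr ?nnegrE ?addr_ge0 ?l2norm_ge0 //.
have := cauchy_schwarz u v.
by rewrite l2norm_sqr !dotE (dotC v u) -!l2norm_sqr; lra.
Qed.

(** Used with [v] a restriction of a vector involving [A^T]: [dot v v] is then a bilinear form in
    which [A^T] moves to the other side. *)
Lemma l2norm_dual n (v : 'cV[R]_n) r :
  0 <= r -> dot v v <= r * l2norm v -> l2norm v <= r.
Proof.
rewrite -l2norm_sqr => r0; have := l2norm_ge0 v.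
have [->//|v0] := eqVneq (l2norm v) 0; rewrite le0r (negbTE v0) /= => vp.
by rewrite expr2 ler_pM2r.
Qed.

Lemma l2norm_le_sqr n (v : 'cV[R]_n) r :
  0 <= r -> dot v v <= r ^+ 2 -> l2norm v <= r.
Proof.
by move=> r0; rewrite -l2norm_sqr ler_sqr ?nnegrE ?l2norm_ge0.
Qed.

Lemma norm_le_l2norm n (v : 'cV[R]_n) i : `|v i 0| <= l2norm v.
Proof.
rewrite -ler_sqr ?nnegrE ?l2norm_ge0 // real_normK ?num_real //.
rewrite l2norm_sqr /dot (bigD1 i) //= expr2 lerDl sumr_ge0 // => j _.
by rewrite -expr2 sqr_ge0.
Qed.

Lemma restrD n W (u v : 'cV[R]_n) : restr W (u + v) = restr W u + restr W v.
Proof.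
by apply/matrixP => i j; rewrite !mxE; case: ifP; rewrite ?addr0.
Qed.

Lemma restrN n W (u : 'cV[R]_n) : restr W (- u) = - restr W u.
Proof.
by apply/matrixP => i j; rewrite !mxE; case: ifP; rewrite ?oppr0.
Qed.

Lemma restrZ n W a (u : 'cV[R]_n) : restr W (a *: u) = a *: restr W u.
Proof.
by apply/matrixP => i j; rewrite !mxE; case: ifP; rewrite ?mulr0.
Qed.

Lemma restr_restr n V W (u : 'cV[R]_n) :
  restr V (restr W u) = restr (V :&: W)%SET u.
Proof.
apply/matrixP => i j; rewrite !mxE inE.
by case: (i \in V); case: (i \in W).
Qed.

Lemma restrC n W (u : 'cV[R]_n) : restr W u + restr (~: W)%SET u = u.
Proof.
apply/matrixP => i j; rewrite ord1 !mxE inE.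
by case: (i \in W); rewrite ?addr0 ?add0r.
Qed.

Lemma supp_restr n W (u : 'cV[R]_n) : supp (restr W u) \subset W.
Proof.
by apply/fintype.subsetP => i; rewrite inE mxE; case: ifP; rewrite ?eqxx.
Qed.

Lemma restr_id n (W : {set 'I_n}) (u : 'cV[R]_n) :
  supp u \subset W -> restr W u = u.
Proof.
move=> /fintype.subsetP h; apply/matrixP => i j; rewrite ord1 !mxE.
case: ifPn => // iW; apply/esym/eqP/negPn/negP => ui.
by move/negP: iW; apply; apply: h; rewrite inE.
Qed.

Lemma dot_restr n W (u v : 'cV[R]_n) :
  dot (restr W u) v = \sum_(i in W) u i 0 * v i 0.
Proof.
rewrite /dot [RHS]big_mkcond; apply: eq_bigr => i _; rewrite !mxE.
by case: ifP; rewrite ?mul0r.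
Qed.

Lemma dot_restr2 n W (u v : 'cV[R]_n) :
  dot (restr W u) (restr W v) = dot (restr W u) v.
Proof. by rewrite !dot_restr; apply: eq_bigr => i iW; rewrite mxE iW. Qed.

Lemma l2norm_restr_sqr n W (u : 'cV[R]_n) :
  l2norm (restr W u) ^+ 2 = \sum_(i in W) u i 0 ^+ 2.
Proof. by rewrite l2norm_sqr dot_restr2 dot_restr. Qed.

Lemma l2norm_splitC n W (u : 'cV[R]_n) :
  l2norm u ^+ 2 = l2norm (restr W u) ^+ 2 + l2norm (restr (~: W)%SET u) ^+ 2.
Proof.
by rewrite !l2norm_sqr !dot_restr2 -dotDl restrC.
Qed.

Lemma l2norm_restr_le n (V W : {set 'I_n}) (u : 'cV[R]_n) :
  V \subset W -> l2norm (restr V u) <= l2norm (restr W u).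
Proof.
move=> VW; rewrite -ler_sqr ?nnegrE ?l2norm_ge0 //.
rewrite !l2norm_restr_sqr [leRHS](big_setID V) /= (finset.setIidPr VW) lerDl.
by rewrite sumr_ge0 // => i _; rewrite sqr_ge0.
Qed.

Lemma l2norm_restr n W (u : 'cV[R]_n) : l2norm (restr W u) <= l2norm u.
Proof.
rewrite -[leRHS](congr1 l2norm (restr_id (finset.subsetT (supp u)))).
by rewrite l2norm_restr_le ?finset.subsetT.
Qed.

End Dot.

(** * Restricted isometry *)

Section RIP.
Context {R : realType} {m n : nat}.
Implicit Types (A : 'M[R]_(m, n)) (t : nat) (d : R) (K : {set 'I_n}).

Lemma suppD (u v : 'cV[R]_n) : supp (u + v) \subset (supp u :|: supp v)%SET.
Proof.
apply/fintype.subsetP => i; rewrite !inE mxE.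
by apply: contraNT; rewrite negb_or !negbK => /andP[/eqP-> /eqP->]; rewrite addr0.
Qed.

Lemma suppZ a (v : 'cV[R]_n) : supp (a *: v) \subset supp v.
Proof.
apply/fintype.subsetP => i; rewrite !inE mxE.
by apply: contraNN => /eqP ->; rewrite mulr0.
Qed.

Lemma suppN (v : 'cV[R]_n) : supp (- v) = supp v.
Proof. by apply/setP => i; rewrite !inE mxE oppr_eq0. Qed.

Lemma rip_le A t t' d : (t' <= t)%N -> rip A t d -> rip A t' d.
Proof. by move=> tt h z zt; apply: h; apply: leq_trans zt tt. Qed.

(** A smallest constant has to exist for [t']. The infimum of the admissible ones is attained,
    because for each nonzero z admissibility of e is the closed condition | |Az|^2 / |z|^2 - 1 | <=
    e. *)
Lemma has_ric_le A t t' : (t' <= t)%N -> has_ric A t -> has_ric A t'.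
Proof.
move=> tt [d [d01 dt _]].
pose E := [set e | 0 <= e < 1 /\ rip A t' e].
have Ed : E d by split => //; exact: rip_le dt.
have lb0 : lbound E 0 by move=> e [] /andP[].
have hlb : has_lbound E by exists 0.
have E0 : E !=set0 by exists d.
have infd : inf E <= d by apply: ge_inf.
exists (inf E); split.
- rewrite lb_le_inf //=; apply: le_lt_trans infd _.
  by case/andP: d01.
- move=> z zt; rewrite !l2norm_sqr.
  have [z0|z0] := eqVneq (dot z z) 0.
    have /l2norm_eq0 -> : l2norm z = 0.
      by apply/eqP; rewrite -sqrf_eq0 l2norm_sqr z0.
    by rewrite mulmx0 !dot0l !mulr0 lexx.
  have zp : 0 < dot z z by rewrite lt0r z0 dot_ge0.
  have bound e : E e -> `|dot (A *m z) (A *m z) / dot z z - 1| <= e.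
    move=> [_ /(_ z zt)]; rewrite !l2norm_sqr => /andP[h1 h2].
    rewrite ler_norml lerBrDr lerBlDr ler_pdivrMr // ler_pdivlMr //.
    by rewrite addrC h1 addrC h2.
  have := lb_le_inf E0 bound.
  rewrite ler_norml lerBrDr lerBlDr ler_pdivrMr // ler_pdivlMr //.
  by rewrite addrC => /andP[-> ]; rewrite addrC.
- by move=> e e01 et; apply: ge_inf.
Qed.

Lemma ricP A t : has_ric A t -> is_ric A t (ric A t).
Proof. by move=> h; exact: xgetPex h. Qed.

Lemma rip_upper A t d (z : 'cV[R]_n) :
  0 <= d -> rip A t d -> (#|supp z| <= t)%N ->
  l2norm (A *m z) <= Num.sqrt (1 + d) * l2norm z.
Proof.
move=> d0 h /h /andP[_ hz].
rewrite -ler_sqr ?nnegrE ?mulr_ge0 ?sqrtr_ge0 ?l2norm_ge0 //.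
by rewrite exprMn (@sqr_sqrtr _ (1 + d)) ?addr_ge0.
Qed.

Lemma rip_lower A t d (z : 'cV[R]_n) :
  d < 1 -> rip A t d -> (#|supp z| <= t)%N ->
  Num.sqrt (1 - d) * l2norm z <= l2norm (A *m z).
Proof.
move=> d0 h /h /andP[hz _].
rewrite -ler_sqr ?nnegrE ?mulr_ge0 ?sqrtr_ge0 ?l2norm_ge0 //.
by rewrite exprMn (@sqr_sqrtr _ (1 - d)) ?subr_ge0 ?(ltW d0).
Qed.

(** Polarization, with the isometry bounds applied to |b|a + |a|b and |b|a - |a|b. Giving both
    summands the same norm yields the product |a||b| rather than a sum of squares. *)
Lemma rip_dot A t d (a b : 'cV[R]_n) :
  rip A t d -> (#|supp a :|: supp b| <= t)%N ->
  dot a b - dot (A *m a) (A *m b) <= d * (l2norm a * l2norm b).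
Proof.
move=> h ab.
have [a0|a0] := eqVneq (l2norm a) 0.
  by rewrite a0 (l2norm_eq0 a0) mulmx0 !dot0l mul0r mulr0 subrr.
have ap : 0 < l2norm a by rewrite lt0r a0 l2norm_ge0.
have [b0|b0] := eqVneq (l2norm b) 0.
  by rewrite b0 (l2norm_eq0 b0) mulmx0 !(dotC _ 0) !dot0l !mulr0 subrr.
have bp : 0 < l2norm b by rewrite lt0r b0 l2norm_ge0.
have sub s r : (#|supp (s *: a + r *: b)| <= t)%N.
  apply: leq_trans ab; apply: subset_leq_card.
  by apply: fintype.subset_trans (suppD _ _) (finset.setUSS _ _); exact: suppZ.
have /andP[_] := h _ (sub (l2norm b) (- l2norm a)).
have /andP[+ _] := h _ (sub (l2norm b) (l2norm a)).
rewrite !l2norm_sqr !mulmxDr -!scalemxAr !dotE (dotC b a) (dotC (A *m b) (A *m a)).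
rewrite -!l2norm_sqr => h1 h2.
by rewrite -(ler_pM2l (mulr_gt0 ap bp)); nra.
Qed.

(** Tested against itself, the restricted vector b gives <b,a> - <Ab,Aa>, which [rip_dot] bounds.
    The restriction to [K] keeps b sparse; A^T A a itself need not be. *)
Lemma rip_resid A t d K (a : 'cV[R]_n) :
  0 <= d -> rip A t d -> (#|supp a :|: K| <= t)%N ->
  l2norm (restr K (a - A^T *m (A *m a))) <= d * l2norm a.
Proof.
move=> d0 h aK; apply: l2norm_dual; first by rewrite mulr_ge0 ?l2norm_ge0.
set b := restr K _; rewrite dot_restr2 -/b dotDr dotNr -dot_mulmx.
rewrite dotC (dotC (A *m b)) -mulrA; apply: (rip_dot h).
by apply: leq_trans aK; apply/subset_leq_card/finset.setUS/supp_restr.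
Qed.

Lemma rip_adjoint A t d K (v : 'cV[R]_m) :
  0 <= d -> rip A t d -> (#|K| <= t)%N ->
  l2norm (restr K (A^T *m v)) <= Num.sqrt (1 + d) * l2norm v.
Proof.
move=> d0 h Kt.
apply: l2norm_dual; first by rewrite mulr_ge0 ?sqrtr_ge0 ?l2norm_ge0.
set b := restr K _; rewrite dot_restr2 -/b -dot_mulmx.
apply: le_trans (cauchy_schwarz _ _) _; rewrite mulrAC ler_wpM2r ?l2norm_ge0 //.
apply: (rip_upper d0 h).
by apply: leq_trans Kt; apply/subset_leq_card/supp_restr.
Qed.

(* With [a] the inverse Gram matrix applied to [g] on [K]: the eigenvalues of
   that inverse lie within [d / (1 - d^2)] of [1 / (1 - d^2)]. *)
Lemma rip_gram_inverse A t d K (a g : 'cV[R]_n) :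
  0 <= d < 1 -> rip A t d -> (#|K| <= t)%N -> supp a \subset K ->
  restr K (A^T *m (A *m a)) = restr K g ->
  l2norm (a - (1 - d ^+ 2)^-1 *: restr K g)
    <= d / (1 - d ^+ 2) * l2norm (restr K g).
Proof.
move=> /andP[d0 d1] h Kt aK E.
have D0 : 0 < 1 - d ^+ 2 by nra.
(* With g restricted to [K], this reads |a - g| <= d|a|. It describes an Apollonius ball with centre
   g / (1 - d^2) and radius d|g| / (1 - d^2); the rest completes the square. *)
have := rip_resid d0 h (K := K) (a := a).
rewrite (finset.setUidPr aK) => /(_ Kt).
rewrite restrD restrN E restr_id //.
rewrite -ler_sqr ?nnegrE ?mulr_ge0 ?l2norm_ge0 // => hr.
rewrite -ler_sqr ?nnegrE ?mulr_ge0 ?l2norm_ge0 ?invr_ge0 ?(ltW D0) //.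
move: hr; rewrite !exprMn !l2norm_sqr !dotE (dotC (restr K g) a).
set p := dot a a; set r := dot a _; set s := dot (restr K g) _ => hr.
set c := (1 - d ^+ 2)^-1.
have c0 : 0 < c by rewrite invr_gt0.
have dE : d ^+ 2 * c = c - 1 by rewrite /c; field; lra.
have -> : d ^+ 2 * c ^+ 2 * s = (c - 1) * c * s by rewrite -dE; ring.
have hc : c * (p - r *+ 2 + s - d ^+ 2 * p) <= 0 by rewrite pmulr_rle0 //; lra.
have hp : p = c * p - d ^+ 2 * c * p by rewrite dE; ring.
lra.
Qed.

End RIP.

(** * The Newton matrix *)

Section Newton.
Context {R : realType} {m n : nat}.
Variables (A : 'M[R]_(m, n)) (W : {set 'I_n}).

Let E : 'M[R]_(n, #|W|) := colsel W 1%:M.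

Lemma colselE : colsel W A = A *m E.
Proof.
apply/matrixP => i j; rewrite !mxE (bigD1 (enum_val j)) //= !mxE eqxx mulr1.
by rewrite big1 ?addr0 // => l lj; rewrite !mxE (negbTE lj) mulr0.
Qed.

Lemma trmx_colsel1_mul : E^T *m E = 1%:M.
Proof.
apply/matrixP => i j; rewrite !mxE (bigD1 (enum_val j)) //= !mxE eqxx mulr1.
rewrite big1 ?addr0 => [|l lj]; last by rewrite !mxE (negbTE lj) mulr0.
by rewrite (inj_eq enum_val_inj) eq_sym.
Qed.

Lemma colsel1_mul_trmx (v : 'cV[R]_n) : E *m (E^T *m v) = restr W v.
Proof.
apply/matrixP => i j; rewrite ord1 !mxE.
have ev l : (E^T *m v) l 0 = v (enum_val l) 0.
  rewrite mxE (bigD1 (enum_val l)) //= !mxE eqxx mul1r.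
  by rewrite big1 ?addr0 // => r rl; rewrite !mxE (negbTE rl) mul0r.
case: ifPn => iW.
  rewrite (bigD1 (enum_rank_in iW i)) //= ev !mxE enum_rankK_in // eqxx mul1r.
  rewrite big1 ?addr0 // => l li; rewrite !mxE; case: eqP => [il|]; last by rewrite mul0r.
  by case/eqP: li; apply: enum_val_inj; rewrite enum_rankK_in.
rewrite big1 // => l _; rewrite !mxE; case: eqP => [il|]; last by rewrite mul0r.
by rewrite il enum_valP in iW.
Qed.

Lemma supp_colsel1_mul (v : 'cV[R]_(#|W|)) : supp (E *m v) \subset W.
Proof.
have <- : restr W (E *m v) = E *m v.
  by rewrite -colsel1_mul_trmx (mulmxA E^T) trmx_colsel1_mul mul1mx.
exact: supp_restr.
Qed.

(** A kernel vector v of the Gram matrix satisfies |A E v|^2 = 0, and the lower isometry bound then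
    forces E v = 0. On a singular matrix [invmx] would not be an inverse. *)
Lemma gram_unit t d : d < 1 -> rip A t d -> (#|W| <= t)%N ->
  (colsel W A)^T *m colsel W A \in unitmx.
Proof.
move=> d1 h Wt; rewrite -row_free_unit; apply: inj_row_free => v.
move=> /(congr1 trmx); rewrite !trmx_mul trmxK trmx0 => v0.
have Ev0 : E *m v^T = 0.
  apply: l2norm_eq0; apply/eqP; rewrite eq_le l2norm_ge0 andbT.
  have sp : 0 < Num.sqrt (1 - d) by rewrite sqrtr_gt0 subr_gt0.
  rewrite -(ler_pM2l sp) mulr0.
  have /(rip_lower d1 h) : (#|supp (E *m v^T)| <= t)%N.
    exact: leq_trans (subset_leq_card (supp_colsel1_mul _)) Wt.
  move=> /le_trans -> //.
  suff -> : A *m (E *m v^T) = 0 by rewrite l2norm0.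
  apply: l2norm_eq0; apply/eqP; rewrite -sqrf_eq0 l2norm_sqr.
  rewrite mulmxA -colselE dot_mulmx.
  rewrite mulmxA.
  have -> : (colsel W A)^T *m colsel W A *m v^T = 0 by [].
  by rewrite dotC dot0l.
apply: (can_inj (@trmxK _ _ _)).
by rewrite -[LHS]mul1mx -trmx_colsel1_mul -mulmxA Ev0 mulmx0 trmx0.
Qed.

Variables (alpha gamma : R).
Let B (g : 'cV[R]_n) := newtonM A alpha W *m scaleZ gamma W *m g.

(** Both factors respect the splitting of the indices into [W] and its complement, and Z is the
    identity on [W]; hence [alpha] and [gamma] enter only through their product. *)
Lemma newton_blocks g :
  B g = E *m (invmx ((colsel W A)^T *m colsel W A) *m (E^T *m g))
        + (alpha * gamma) *: restr (~: W)%SET g.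
Proof.
have sZ : restr W (scaleZ gamma W *m g) = restr W g.
  apply/matrixP => i j; rewrite !mxE; case: ifP => // iW.
  rewrite (bigD1 i) //= !mxE eqxx mulr1n iW mul1r big1 ?addr0 // => l li.
  by rewrite !mxE eq_sym (negbTE li) mulr0n mul0r.
have sE : E^T *m (scaleZ gamma W *m g) = E^T *m g.
  rewrite -[LHS]mul1mx -[RHS]mul1mx -trmx_colsel1_mul -!mulmxA.
  by rewrite !colsel1_mul_trmx sZ.
rewrite /B /newtonM -mulmxA mulmxDl -!mulmxA sE; congr (_ + _).
rewrite /scaleZ mulmxA mulmx_diag; apply/matrixP => i j; rewrite ord1.
rewrite !mxE (bigD1 i) //= !mxE eqxx mulr1n big1 => [|l li]; last first.
  by rewrite !mxE eq_sym (negbTE li) mulr0n mul0r.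
by rewrite inE addr0; case: ifP; rewrite ?mul0r ?mulr0.
Qed.

(** The interval [1/(1+d), 1/(1-d)] has midpoint 1/(1-d^2) and half-length d/(1-d^2). Each block
    deviates from the midpoint by at most the half-length, and the two blocks are orthogonal, so
    their squares add. *)
Lemma newton_dev t d g : 0 <= d < 1 -> rip A t d -> (#|W| <= t)%N ->
  1 / (1 + d) <= alpha * gamma <= 1 / (1 - d) ->
  l2norm (B g - (1 - d ^+ 2)^-1 *: g) <= d / (1 - d ^+ 2) * l2norm g.
Proof.
move=> d01 h Wt /andP[ag1 ag2]; have /andP[d0 d1] := d01.
have D0 : 0 < 1 - d ^+ 2 by nra.
have U := gram_unit d1 h Wt.
set a := E *m (invmx ((colsel W A)^T *m colsel W A) *m (E^T *m g)).
have aW : supp a \subset W by exact: supp_colsel1_mul.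
have aE : restr W (A^T *m (A *m a)) = restr W g.
  rewrite -!colsel1_mul_trmx; congr (_ *m _).
  rewrite /a (mulmxA A) -colselE (mulmxA A^T) (mulmxA E^T) (mulmxA E^T).
  by rewrite -trmx_mul -colselE (mulmxA _ (invmx _)) mulmxV // mul1mx.
have hin := rip_gram_inverse d01 h Wt aW aE.
rewrite newton_blocks -/a.
have restr_in : restr W (a + (alpha * gamma) *: restr (~: W)%SET g
    - (1 - d ^+ 2)^-1 *: g) = a - (1 - d ^+ 2)^-1 *: restr W g.
  rewrite !restrD restrN !restrZ restr_restr finset.setICr (restr_id aW).
  suff -> : restr finset.set0 g = 0 by rewrite scaler0 addr0.
  by apply/matrixP => i j; rewrite !mxE inE.
have restr_out : restr (~: W)%SET (a + (alpha * gamma) *: restr (~: W)%SET g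
    - (1 - d ^+ 2)^-1 *: g)
    = (alpha * gamma - (1 - d ^+ 2)^-1) *: restr (~: W)%SET g.
  rewrite !restrD restrN !restrZ restr_restr finset.setIid -(restr_id aW).
  rewrite restr_restr [(~: W :&: W)%SET]finset.setIC finset.setICr scalerBl.
  suff -> : restr finset.set0 a = 0 by rewrite add0r.
  by apply/matrixP => i j; rewrite !mxE inE.
rewrite -ler_sqr ?nnegrE ?mulr_ge0 ?l2norm_ge0 ?invr_ge0 ?(ltW D0) //.
rewrite (l2norm_splitC W) restr_in restr_out exprMn (l2norm_splitC W g) mulrDr.
apply: lerD.
  rewrite -exprMn ler_sqr ?nnegrE ?mulr_ge0 ?l2norm_ge0 ?invr_ge0 ?(ltW D0) //.
rewrite l2normZ -!exprMn.
rewrite ler_sqr ?nnegrE ?mulr_ge0 ?l2norm_ge0 ?invr_ge0 ?(ltW D0) //.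
rewrite ler_wpM2r ?l2norm_ge0 //.
have e1 : 1 / (1 + d) = (1 - d ^+ 2)^-1 - d / (1 - d ^+ 2).
  by field; apply/andP; split; lra.
have e2 : 1 / (1 - d) = (1 - d ^+ 2)^-1 + d / (1 - d ^+ 2).
  by field; apply/andP; split; lra.
by rewrite ler_norml; lra.
Qed.

Lemma newton_norm t d g : 0 <= d < 1 -> rip A t d -> (#|W| <= t)%N ->
  1 / (1 + d) <= alpha * gamma <= 1 / (1 - d) ->
  l2norm (B g) <= (1 - d)^-1 * l2norm g.
Proof.
move=> d01 h Wt ag; have := newton_dev g d01 h Wt ag.
move: d01 => /andP[d0 d1]; have D0 : 0 < 1 - d ^+ 2 by nra.
set c := _^-1 => dev.
have -> : B g = (B g - c *: g) + c *: g by rewrite subrK.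
apply: le_trans (l2normD _ _) _; rewrite l2normZ ger0_norm ?invr_ge0 ?(ltW D0) //.
have -> : (1 - d)^-1 = d / (1 - d ^+ 2) + c.
  by rewrite /c; field; apply/andP; split; lra.
by rewrite mulrDl lerD2r.
Qed.

(** With c the midpoint above, I - lambda B = (1 - lambda c) I - lambda (B - c I); the sum of the
    two norm bounds is the larger of the values at the ends of the interval. *)
Lemma newton_contract t d lambda g : 0 <= d < 1 -> rip A t d ->
  (#|W| <= t)%N -> 0 <= lambda ->
  1 / (1 + d) <= alpha * gamma <= 1 / (1 - d) ->
  l2norm (g - lambda *: B g) <= DeltaL lambda d * l2norm g.
Proof.
move=> d01 h Wt l0 ag; have := newton_dev g d01 h Wt ag.
move: d01 => /andP[d0 d1]; have D0 : 0 < 1 - d ^+ 2 by nra.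
set c := _^-1 => dev.
have -> : g - lambda *: B g = (1 - lambda * c) *: g - lambda *: (B g - c *: g).
  by rewrite scalerBr scalerA scalerBl scale1r opprB addrA subrK.
apply: le_trans (l2normD _ _) _; rewrite l2normN !l2normZ (ger0_norm l0).
apply: (@le_trans _ _ ((`|1 - lambda * c| + lambda * (d / (1 - d ^+ 2)))
                       * l2norm g)).
  by rewrite mulrDl lerD2l -mulrA ler_wpM2l.
apply: ler_wpM2r; first exact: l2norm_ge0.
have e1 : 1 - lambda / (1 + d)
    = 1 - lambda * c + lambda * (d / (1 - d ^+ 2)).
  by rewrite /c; field; apply/andP; split; lra.
have e2 : 1 - lambda / (1 - d)
    = 1 - lambda * c - lambda * (d / (1 - d ^+ 2)).
  by rewrite /c; field; apply/andP; split; lra.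
(* The sign of [p] decides which end of the interval attains the maximum. *)
rewrite /DeltaL e1 e2 le_max; set p := 1 - lambda * c.
have := ler_norm (p + lambda * (d / (1 - d ^+ 2))).
have := ler_norm (- (p - lambda * (d / (1 - d ^+ 2)))); rewrite normrN.
have [p0|p0] := ger0P p => h1 h2.
  by rewrite h2 orbT.
by apply/orP; left; lra.
Qed.

End Newton.

(** * Blocks, the hypersimplex and hard thresholding *)

Section Blocks.
Context {R : realType} {n : nat}.
Implicit Types (g z v w : 'cV[R]_n) (K S : {set 'I_n}).

Lemma ceil_div_ge k : (0 < k)%N -> (0 < n)%N ->
  (n.-1 %/ k).+1%:R <= ceil_div n k :> R.
Proof.
move=> k0 n0.
have -> : (n.-1 %/ k).+1%:R = (Posz (n.-1 %/ k).+1)%:~R :> R by [].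
rewrite ler_int -addn1 PoszD lezD1 ceil_gt_int ltr_pdivlMr ?ltr0n //.
by rewrite -natrM ltr_nat; apply: leq_ltn_trans (leq_trunc_div _ _) _; rewrite prednK.
Qed.

(** The indices are grouped by their quotient by k, and the squared norms of the blocks add up. *)
Lemma l2norm_blocks k g r : (0 < k)%N -> (0 < n)%N -> 0 <= r ->
  (forall K, (#|K| <= k)%N -> l2norm (restr K g) <= r) ->
  l2norm g <= Num.sqrt (ceil_div n k) * r.
Proof.
move=> k0 n0 r0 hK.
have N0 := le_trans (ler0n _ _) (ceil_div_ge k0 n0).
apply: l2norm_le_sqr; first by rewrite mulr_ge0 ?sqrtr_ge0.
rewrite exprMn sqr_sqrtr //.
pose bl (i : 'I_n) : 'I_(n.-1 %/ k).+1 := inord (i %/ k).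
rewrite /dot (partition_big bl xpredT) //=.
apply: (@le_trans _ _ (\sum_(j < (n.-1 %/ k).+1) r ^+ 2)); last first.
  rewrite sumr_const card_ord -mulr_natl ler_wpM2r ?sqr_ge0 //.
  exact: ceil_div_ge.
apply: ler_sum => j _.
pose K := [set i | bl i == j]%SET.
have Kk : (#|K| <= k)%N.
  (* Within one block the remainder determines the index. *)
  pose f (i : 'I_n) : 'I_k := Ordinal (ltn_pmod i k0).
  have fi : {in K &, injective f}.
    move=> a b; rewrite !inE => /eqP <- /eqP/(congr1 val) ba /(congr1 val) /= ab.
    (* The quotient is in range, so [inord] never takes its default value. *)
    have dv (i : 'I_n) : (i %/ k < (n.-1 %/ k).+1)%N.
      by rewrite ltnS leq_div2r // -ltnS prednK.
    apply: val_inj => /=; rewrite (divn_eq a k) (divn_eq b k) ab.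
    by move: ba; rewrite /bl /= !inordK // => ->.
  by rewrite -(card_in_imset fi) -[leqRHS](card_ord k) max_card.
rewrite (_ : \sum_(i | _) _ = l2norm (restr K g) ^+ 2).
  by rewrite ler_sqr ?nnegrE ?l2norm_ge0 ?hK.
by rewrite l2norm_restr_sqr; apply: eq_big => i; rewrite ?inE // expr2.
Qed.

Section Hypersimplex.
Variable k : nat.

Let frac w := [set i | 0 < w i 0 < 1]%SET.
(** Mass moves from j to i until entry i reaches 1 or entry j reaches 0. *)
Let shift i j w : 'cV[R]_n :=
  w + Num.min (1 - w i 0) (w j 0) *: (delta_mx i 0 - delta_mx j 0).

Let shiftE i j w l : i != j -> shift i j w l 0 =
  if l == i then w i 0 + Num.min (1 - w i 0) (w j 0)
  else if l == j then w j 0 - Num.min (1 - w i 0) (w j 0) else w l 0.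
Proof.
move=> ij; rewrite !mxE eqxx !andbT !mulrb.
case: (eqVneq l i) => [->|li]; first by rewrite (negbTE ij) subr0 mulr1.
by case: (eqVneq l j) => [->|lj]; rewrite sub0r ?oppr0 ?mulr0 ?addr0 ?mulrN1.
Qed.

Let shift_relaxed i j w : i != j -> relaxed_weight k w ->
  relaxed_weight k (shift i j w).
Proof.
move=> ij [ws w01]; split.
  have split2 (F : 'I_n -> R) : \sum_l F l
      = F i + (F j + \sum_(l | (l != i) && (l != j)) F l).
    by rewrite (bigD1 i) //= (bigD1 j) //= eq_sym.
  rewrite -ws !split2.
  rewrite !shiftE // eqxx eq_sym (negbTE ij) eqxx !addrA.
  congr (_ + _); first by ring.
  by apply: eq_bigr => l /andP[li lj]; rewrite shiftE // (negbTE li) (negbTE lj).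
move=> l; have := w01 i; have := w01 j; have := w01 l; rewrite shiftE //.
by case: (lerP (1 - w i 0) (w j 0)) => h; do 2?case: eqP => _; lra.
Qed.

(** Only entries i and j change, and the one that attains the minimum becomes integral. *)
Let shift_frac i j w : i != j -> i \in frac w -> j \in frac w ->
  (#|frac (shift i j w)| < #|frac w|)%N.
Proof.
move=> ij iw jw; apply: proper_card; apply/properP; split.
  apply/fintype.subsetP => l; rewrite inE shiftE //.
  by do 2?[case: eqVneq => [->//|_]]; rewrite inE.
have [h|h] := lerP (1 - w i 0) (w j 0).
  by exists i => //; rewrite inE shiftE // eqxx min_l // addrC subrK ltxx andbF.
exists j => //; rewrite inE shiftE // eq_sym (negbTE ij) eqxx min_r ?(ltW h) //.
by rewrite subrr ltxx.
Qed.

(** Were i the only fractional index, the other entries would sum to a natural number c with c < k <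
    c + 1. *)
Let frac_pair w i : relaxed_weight k w -> i \in frac w ->
  exists2 j, i != j & j \in frac w.
Proof.
move=> [ws w01] iw.
suff /existsP[j /andP[ij jw]] : [exists j, (i != j) && (j \in frac w)] by exists j.
apply: contraT.
rewrite negb_exists => /forallP nf; exfalso.
have e01 l : l != i -> w l 0 = (w l 0 == 1)%:R.
  move=> li; have := nf l; rewrite eq_sym li /= inE.
  have /andP[h0 h1] := w01 l.
  rewrite lt0r h0 andbT lt_neqAle h1 andbT negb_and !negbK.
  by case/orP => /eqP ->; rewrite ?eqxx // eq_sym oner_eq0.
move: iw; rewrite inE => /andP[i0 i1].
move: ws; rewrite (bigD1 i) //= (eq_bigr _ e01) -natr_sum.
set c := (\sum_(_ | _) _)%N => ws.
have /andP[] : (c < k)%N && (k < c.+1)%N.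
  by rewrite -!(ltr_nat R) -natr1 -ws ltrDr i0 addrC ltrD2l i1.
by rewrite ltnS => /leq_trans h /h; rewrite ltnn.
Qed.

(* The extreme points of the hypersimplex are the indicators of [k]-sets: a
   point with two fractional entries is interior to a segment along
   [e_i - e_j] whose endpoints have fewer fractional entries. *)
Lemma relaxed_weight_ind (P : 'cV[R]_n -> Prop) :
  (forall w1 w2 t, 0 <= t <= 1 -> P w1 -> P w2 -> P (t *: w1 + (1 - t) *: w2)) ->
  (forall K, #|K| = k -> P (restr K (const_mx 1))) ->
  forall w, relaxed_weight k w -> P w.
Proof.
move=> Pconv Pind w; have [N] := ubnP #|frac w|.
elim: N w => // N IH w wN wk.
have [f0|[i iw]] := set_0Vmem (frac w).
  pose K := [set i | w i 0 == 1]%SET.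
  have wE : w = restr K (const_mx 1).
    apply/matrixP => l c; rewrite ord1 !mxE inE; case: eqP => [->//|w1].
    have : l \notin frac w by rewrite f0 inE.
    have [_ /(_ l)/andP[h0 h1]] := wk.
    rewrite inE lt0r h0 andbT [_ < 1]lt_neqAle h1 andbT negb_and !negbK.
    by case/orP => /eqP.
  rewrite wE; apply: Pind; have [+ _] := wk.
  rewrite {1}wE (eq_bigr (fun i => (i \in K)%:R)) => [|l _]; last first.
    by rewrite !mxE; case: ifP.
  by rewrite -natr_sum -big_mkcond sum1_card => /eqP; rewrite eqr_nat => /eqP.
have [j ij jw] := frac_pair wk iw.
have ji : j != i by rewrite eq_sym.
have P1 : P (shift i j w).
  by apply: IH (shift_relaxed ij wk); apply: leq_trans (shift_frac ij iw jw) _.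
have P2 : P (shift j i w).
  by apply: IH (shift_relaxed ji wk); apply: leq_trans (shift_frac ji jw iw) _.
pose s := Num.min (1 - w i 0) (w j 0); pose t := Num.min (1 - w j 0) (w i 0).
have s0 : 0 < s by move: iw jw; rewrite !inE lt_min subr_gt0 => /andP[_ ->] /andP[].
have t0 : 0 < t by move: iw jw; rewrite !inE lt_min subr_gt0 => /andP[-> _] /andP[_ ->].
(* The displacements have lengths [s] and [t] in opposite directions, so these weights cancel
   them. *)
have -> : w = (t / (s + t)) *: shift i j w + (1 - t / (s + t)) *: shift j i w.
  have -> : 1 - t / (s + t) = s / (s + t) by field; lra.
  rewrite /shift -/s -/t; apply/matrixP => l c; rewrite !mxE; field; lra.
apply: Pconv => //.
by rewrite divr_ge0 ?addr_ge0 ?(ltW s0) ?(ltW t0) //= ler_pdivrMr ?mul1r; lra.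
Qed.

End Hypersimplex.

Lemma golden_gt1 : 1 < golden :> R.
Proof.
have : 1 < Num.sqrt 5 :> R by rewrite -[X in X < _]sqrtr1 ltr_sqrt ?ltr1n.
by rewrite /golden; lra.
Qed.

Lemma golden_sqr : golden ^+ 2 = golden + 1 :> R.
Proof.
have : Num.sqrt 5 ^+ 2 = 5 :> R by rewrite sqr_sqrtr.
by rewrite /golden => h; rewrite !expr2 in h *; nra.
Qed.

(** Every entry on X \ S dominates every entry on S \ X, and X \ S is at least as large. After
    multiplication by its cardinality, the sums of squares are compared over pairs of indices. *)
Lemma top_rule_dominates (T : nat -> 'cV[R]_n -> {set 'I_n}) t z S :
  top_rule T -> (#|S| <= #|T t z|)%N ->
  l2norm (restr (S :\: T t z)%SET z) <= l2norm (restr (T t z :\: S)%SET z).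
Proof.
move=> hT SX; have [_ top] := hT t z; set X := T t z in SX top *.
have SXc : (#|S :\: X| <= #|X :\: S|)%N.
  by move: SX; rewrite -(cardsID X S) -(cardsID S X) finset.setIC leq_add2l.
rewrite -ler_sqr ?nnegrE ?l2norm_ge0 // !l2norm_restr_sqr.
have [X0|X0] := posnP #|X :\: S|%SET.
  move: SXc; rewrite X0 leqn0 cards_eq0 => /eqP ->.
  by rewrite big_set0 sumr_ge0 // => i _; exact: sqr_ge0.
have XR : 0 < #|(X :\: S)%SET|%:R :> R by rewrite ltr0n.
rewrite -(ler_pM2l XR).
apply: (@le_trans _ _ (#|(S :\: X)%SET|%:R * \sum_(i in (X :\: S)%SET) z i 0 ^+ 2));
  last first.
  rewrite ler_wpM2r ?ler_nat // sumr_ge0 // => i _; exact: sqr_ge0.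
rewrite !mulr_natl -!sumr_const exchange_big /=.
apply: ler_sum => i; rewrite inE => /andP[iX iS].
apply: ler_sum => j; rewrite inE => /andP[jS jX].
rewrite -[z j 0 ^+ 2]real_normK ?num_real //.
rewrite -[z i 0 ^+ 2]real_normK ?num_real //.
by rewrite ler_sqr ?nnegrE // top.
Qed.

(** Let p and r be the norms of z - v on X and on S \ X. The error is p on X; on S \ X it is |v| <=
    r + p, since there |z| is at most its norm on X \ S, where v vanishes. The form p^2 + (r + p)^2
    has largest eigenvalue [golden ^+ 2]. *)
Lemma hard_thr_golden (T : nat -> 'cV[R]_n -> {set 'I_n}) t z v S :
  top_rule T -> (#|S| <= #|T t z|)%N -> supp v \subset S ->
  l2norm (hard_thr T t z - v) <= golden * l2norm (restr (S :|: T t z)%SET (z - v)).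
Proof.
move=> hT SX vS; have dom := top_rule_dominates hT SX.
rewrite /hard_thr; set X := T t z in dom SX *.
have v0 i : i \notin S -> v i 0 = 0.
  by move=> iS; rewrite -(restr_id vS) mxE (negbTE iS).
have g1 := golden_gt1; have g2 := golden_sqr.
set p := l2norm (restr X (z - v)); set r := l2norm (restr (S :\: X)%SET (z - v)).
have p0 : 0 <= p := l2norm_ge0 _; have r0 : 0 <= r := l2norm_ge0 _.
have vle : l2norm (restr (S :\: X)%SET v) <= r + p.
  have -> : restr (S :\: X)%SET v
      = restr (S :\: X)%SET z - restr (S :\: X)%SET (z - v).
    by rewrite restrD restrN opprB addrC subrK.
  apply: le_trans (l2normD _ _) _; rewrite l2normN addrC lerD2l.
  apply: le_trans dom _.
  have -> : restr (X :\: S)%SET z = restr (X :\: S)%SET (z - v).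
    apply/matrixP => i j; rewrite !mxE inE; case: ifP => // /andP[iS _].
    by rewrite v0 // subr0.
  exact/l2norm_restr_le/finset.subsetDl.
rewrite -ler_sqr ?nnegrE ?mulr_ge0 ?l2norm_ge0 ?(le_trans ler01 (ltW g1)) //.
rewrite exprMn (l2norm_splitC X).
have -> : restr X (restr X z - v) = restr X (z - v).
  by rewrite !restrD restr_restr finset.setIid.
have -> : restr (~: X)%SET (restr X z - v) = - restr (S :\: X)%SET v.
  apply/matrixP => i j; rewrite ord1 !mxE !inE.
  case: (boolP (i \in X)) => _ /=; first by rewrite oppr0.
  by case: (boolP (i \in S)) => [_|/v0 ->]; rewrite sub0r.
have -> : l2norm (restr (S :|: X)%SET (z - v)) ^+ 2 = p ^+ 2 + r ^+ 2.
  rewrite !l2norm_restr_sqr (big_setID X) /= finset.setIC finset.setKU.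
  by rewrite finset.setDUl finset.setDv finset.setU0.
rewrite l2normN g2.
set s := l2norm _ in vle *; have s0 : 0 <= s := l2norm_ge0 _.
have s2 : s ^+ 2 <= (r + p) ^+ 2 by rewrite ler_sqr ?nnegrE ?addr_ge0.
have gg : golden * (golden - 1) = 1 :> R by rewrite mulrBr mulr1 -expr2 g2; lra.
(* This square is exactly the gap [golden ^+ 2] (p^2 + r^2) - p^2 - (r + p)^2. *)
have : 0 <= golden * (r - (golden - 1) * p) ^+ 2.
  by rewrite mulr_ge0 ?sqr_ge0 //; lra.
have -> : golden * (r - (golden - 1) * p) ^+ 2 = golden * r ^+ 2
   - (golden * (golden - 1)) * (r * p) *+ 2
   + (golden * (golden - 1)) * (golden - 1) * p ^+ 2 by ring.
by rewrite gg -/p; lra.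
Qed.

End Blocks.

(** * One step of the algorithm *)

Section Iteration.
Context {R : realType} {m n : nat}.
Variables (A : 'M[R]_(m, n)) (T : nat -> 'cV[R]_n -> {set 'I_n}).
Hypothesis hT : top_rule T.

Lemma card_top_supp t z : (#|top_supp T t z| <= t)%N.
Proof.
apply: leq_trans (subset_leq_card (supp_restr _ _)) _.
by rewrite (hT t z).1 geq_minl.
Qed.

Lemma restr_hadamard K (w u : 'cV[R]_n) :
  restr K (hadamard w u) = hadamard w (restr K u).
Proof.
by apply/matrixP => i j; rewrite !mxE; case: ifP; rewrite ?mulr0 //= => _; rewrite ord1.
Qed.

(** The left side is convex in [w], so by [relaxed_weight_ind] it suffices to treat indicators of
    k-sets, for which the weighted vector is k-sparse. *)
Lemma rip_hadamard k d (u w : 'cV[R]_n) (r : R) :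
  0 <= d -> rip A k d -> relaxed_weight k w ->
  (forall K : {set 'I_n}, #|K| = k -> l2norm (restr K u) <= r) ->
  l2norm (A *m hadamard w u) <= Num.sqrt (1 + d) * r.
Proof.
move=> d0 h wk hK; move: w wk; apply: relaxed_weight_ind.
  move=> w1 w2 t /andP[t0 t1] h1 h2.
  have -> : hadamard (t *: w1 + (1 - t) *: w2) u
          = t *: hadamard w1 u + (1 - t) *: hadamard w2 u.
    by apply/matrixP => i j; rewrite !mxE mulrDl !mulrA.
  rewrite mulmxDr -!scalemxAr; apply: le_trans (l2normD _ _) _.
  rewrite !l2normZ !ger0_norm ?subr_ge0 //.
  have := ler_wpM2l t0 h1; have : 0 <= 1 - t by rewrite subr_ge0.
  by move=> /ler_wpM2l/(_ _ _ h2); lra.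
move=> K Kk.
have -> : hadamard (restr K (const_mx 1)) u = restr K u.
  by apply/matrixP => i j; rewrite !mxE ord1; case: ifP; rewrite ?mul1r ?mul0r.
apply: (@le_trans _ _ (Num.sqrt (1 + d) * l2norm (restr K u))).
  by apply: (rip_upper d0 h); rewrite -Kk subset_leq_card ?supp_restr.
by rewrite ler_wpM2l ?sqrtr_ge0 ?hK.
Qed.

(* The weighted vector is not sparse: its part off [U] is controlled through
   [rip_hadamard]. *)
Lemma thresholding_error k dk d2k (K0 : {set 'I_n}) (v u w : 'cV[R]_n)
    (y e : 'cV[R]_m) (E : R) :
  0 <= dk -> rip A k dk -> d2k < 1 -> rip A (2 * k) d2k ->
  (k <= n)%N -> supp v \subset K0 -> #|K0| = k ->
  y = A *m v + e -> is_opt_weight A y k u w ->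
  (forall K : {set 'I_n}, (#|K| <= k)%N -> l2norm (restr K (u - v)) <= E) ->
  l2norm (hard_thr T k (hadamard w u) - v) <=
  golden / Num.sqrt (1 - d2k) * (2 * Num.sqrt (1 + dk) * E + 2 * l2norm e).
Proof.
move=> dk0 hk d21 h2k kn vK K0k ye [wk wopt] hE.
have Xk z : #|T k z| = k by rewrite (hT k z).1 (minn_idPl kn).
have KX : (#|K0| <= #|T k (hadamard w u)|)%N by rewrite Xk K0k.
apply: le_trans (hard_thr_golden hT KX vK) _.
set U := (K0 :|: _)%SET; set z := hadamard w u in U KX *.
have sp : 0 < Num.sqrt (1 - d2k) by rewrite sqrtr_gt0 subr_gt0.
rewrite -mulrA ler_wpM2l ?(le_trans ler01) ?(ltW golden_gt1) //.
rewrite mulrC ler_pdivlMr // mulrC.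
have U2k : (#|U| <= 2 * k)%N.
  by rewrite mul2n -addnn -{1}K0k -(Xk z) leq_card_setU.
apply: le_trans (rip_lower d21 h2k _) _.
  by apply: leq_trans U2k; apply/subset_leq_card/supp_restr.
(* Off [U] the vector [v] vanishes, so [u] may be replaced by [u - v]. *)
have off : l2norm (A *m restr (~: U)%SET z) <= Num.sqrt (1 + dk) * E.
  rewrite restr_hadamard; apply: (rip_hadamard dk0 hk wk) => K Kk.
  rewrite restr_restr.
  have -> : restr (K :&: ~: U)%SET u = restr (K :&: ~: U)%SET (u - v).
    apply/matrixP => i j; rewrite ord1 !mxE !inE; case: ifP => // /andP[_ /norP[iK _]].
    by rewrite -[in RHS](restr_id vK) mxE (negbTE iK) subr0.
  by apply: hE; apply: leq_trans (subset_leq_card (finset.subsetIl _ _)) _; rewrite Kk.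
(* The competitor is the indicator of [K0], feasible because [K0] has exactly k elements. *)
have opt : l2norm (y - A *m z) <= Num.sqrt (1 + dk) * E + l2norm e.
  have w0k : relaxed_weight k (restr K0 (const_mx 1) : 'cV[R]_n).
    split=> [|i]; last by rewrite !mxE; case: ifP; rewrite ?lexx ?ler01.
    rewrite (eq_bigr (fun i => (i \in K0)%:R)) => [|l _]; last first.
      by rewrite !mxE; case: ifP.
    by rewrite -natr_sum -big_mkcond sum1_card K0k.
  have := wopt _ w0k; rewrite ler_sqr ?nnegrE ?l2norm_ge0 // => /le_trans; apply.
  have -> : hadamard (restr K0 (const_mx 1)) u = restr K0 u.
    by apply/matrixP => i j; rewrite !mxE ord1; case: ifP; rewrite ?mul1r ?mul0r.
  have -> : y - A *m restr K0 u = - (A *m restr K0 (u - v)) + e.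
    rewrite ye restrD restrN (restr_id vK) mulmxDr mulmxN opprD opprK addrAC.
    by congr (_ + _); rewrite addrC.
  apply: le_trans (l2normD _ _) _; rewrite l2normN lerD2r.
  apply: (@le_trans _ _ (Num.sqrt (1 + dk) * l2norm (restr K0 (u - v)))).
    by apply: (rip_upper dk0 hk); rewrite -K0k subset_leq_card ?supp_restr.
  by rewrite ler_wpM2l ?sqrtr_ge0 ?hE ?K0k.
(* Each bracket contributes one [E] term and one noise term, whence both factors 2. *)
have -> : A *m restr U (z - v) = - (y - A *m z) + (e - A *m restr (~: U)%SET z).
  rewrite restrD restrN (restr_id (fintype.subset_trans vK _)) ?finset.subsetUl //.
  have -> : A *m z = A *m restr U z + A *m restr (~: U)%SET z.
    by rewrite -mulmxDr restrC.
  rewrite ye mulmxBr.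
  by apply/matrixP => i j; rewrite !mxE; ring.
apply: le_trans (l2normD _ _) _; rewrite l2normN.
have := l2normD e (- (A *m restr (~: U)%SET z)); rewrite l2normN.
lra.
Qed.

Lemma newton_error k q dk d3k dq lambda alpha gamma (v x : 'cV[R]_n)
    (y e : 'cV[R]_m) (K : {set 'I_n}) :
  (0 < k)%N -> (0 < n)%N ->
  0 <= dk -> rip A k dk -> 0 <= d3k -> rip A (3 * k) d3k ->
  0 <= dq < 1 -> rip A q dq -> 0 <= lambda ->
  1 / (1 + dq) <= alpha * gamma <= 1 / (1 - dq) ->
  (#|supp v| <= k)%N -> (#|supp x| <= k)%N -> y = A *m x + e ->
  (#|K| <= k)%N ->
  l2norm (restr K (newton_step T A y q lambda alpha gamma v - x)) <=
  (d3k + DeltaL lambda dq * (1 + Num.sqrt (ceil_div n k) * d3k)) * l2norm (v - x)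
  + lambda / (1 - dq) * (Num.sqrt (ceil_div n k) * (Num.sqrt (1 + dk) * l2norm e)).
Proof.
move=> k0 n0 dk0 hk d30 h3k dq01 hq l0 ag vk xk ye Kk.
rewrite /newton_step; set W := top_supp T q _.
have Wq : (#|W| <= q)%N by exact: card_top_supp.
set B := newtonM A alpha W *m scaleZ gamma W; pose a := v - x.
(* The difference [a] of two k-sparse vectors uses 2k indices, and [L] another k. *)
have sub3 (L : {set 'I_n}) : (#|L| <= k)%N -> (#|supp a :|: L| <= 3 * k)%N.
  move=> Lk; apply: leq_trans (leq_card_setU _ _) _.
  rewrite (mulSn 2) addnC; apply: leq_add => //.
  apply: leq_trans (subset_leq_card (suppD _ _)) _.
  apply: leq_trans (leq_card_setU _ _) _.
  by rewrite mul2n -addnn suppN leq_add.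
have resid (L : {set 'I_n}) (Lk : (#|L| <= k)%N) := rip_resid d30 h3k (sub3 _ Lk).
set H := A^T *m (A *m a) in resid.
have -> : v + lambda *: (B *m (A^T *m (y - A *m v))) - x
        = (a - H) + (H - lambda *: (B *m H)) + lambda *: (B *m (A^T *m e)).
  have -> : A^T *m (y - A *m v) = A^T *m e - H.
    rewrite -mulmxBr; congr (_ *m _); rewrite ye /a mulmxBr opprB.
    by rewrite addrA [e + _]addrC.
  rewrite mulmxBr scalerBr /a.
  move: (H) (lambda *: _) (lambda *: _) => H1 F G.
  by apply/matrixP => i j; rewrite !mxE; ring.
have Delta0 : 0 <= DeltaL lambda dq by rewrite /DeltaL le_max normr_ge0.
(* [H] is not sparse, but [a - H] is small on every set of k indices, so the block bound applies to
   it. *)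
have Hle : l2norm H <= (1 + Num.sqrt (ceil_div n k) * d3k) * l2norm a.
  rewrite -[H](subKr a); apply: le_trans (l2normD _ _) _; rewrite l2normN.
  rewrite mulrDl mul1r lerD2l -mulrA; apply: l2norm_blocks => //.
  by rewrite mulr_ge0 ?l2norm_ge0.
have ele : l2norm (A^T *m e)
    <= Num.sqrt (ceil_div n k) * (Num.sqrt (1 + dk) * l2norm e).
  apply: l2norm_blocks => //; first by rewrite mulr_ge0 ?sqrtr_ge0 ?l2norm_ge0.
  by move=> L Lk; exact: (rip_adjoint e dk0 hk Lk).
rewrite restrD; apply: le_trans (l2normD _ _) _; apply: lerD.
  rewrite restrD; apply: le_trans (l2normD _ _) _; rewrite mulrDl.
  apply: lerD; first exact: resid.
  apply: le_trans (l2norm_restr _ _) _.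
  apply: le_trans (newton_contract H dq01 hq Wq l0 ag) _.
  by rewrite -mulrA ler_wpM2l.
apply: le_trans (l2norm_restr _ _) _.
rewrite l2normZ ger0_norm // -[leRHS]mulrA ler_wpM2l //.
apply: le_trans (newton_norm (A^T *m e) dq01 hq Wq ag) _.
by rewrite ler_wpM2l // invr_ge0; lra.
Qed.

End Iteration.

(** * The root beta and the window for the step length *)

Section StepLength.
Context {R : realType}.

(** The polynomial is -1 at 0, positive at 1, and strictly increasing on positive arguments. *)
Lemma quintic_root (a b c d : R) : 0 <= a -> 0 <= b -> 0 <= c -> 0 < d ->
  exists! t, 0 < t < 1
    /\ a * t ^+ 5 + b * t ^+ 4 + c * t ^+ 3 + d * t ^+ 2 + t - 1 = 0.
Proof.
move=> a0 b0 c0 d0.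
pose p : {poly R} := a *: 'X^5 + b *: 'X^4 + c *: 'X^3 + d *: 'X^2 + 'X - 1.
have pE t : p.[t] = a * t ^+ 5 + b * t ^+ 4 + c * t ^+ 3 + d * t ^+ 2 + t - 1.
  by rewrite /p !hornerE.
have [||t /andP[t0 t1] /eqP] := @Num.Theory.poly_ivt R p 0 1.
- exact: ler01.
- by rewrite !pE !expr0n !expr1n /=; lra.
rewrite pE => pt; exists t; split.
  split=> //; rewrite !lt_neqAle t0 t1 !andbT; apply/andP; split.
    by apply/eqP => z; move: pt; rewrite -z !expr0n /=; lra.
  by apply/eqP => z; move: pt; rewrite z !expr1n /=; lra.
have mono u v : 0 < u -> u < v ->
    a * u ^+ 5 + b * u ^+ 4 + c * u ^+ 3 + d * u ^+ 2 + u - 1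
    < a * v ^+ 5 + b * v ^+ 4 + c * v ^+ 3 + d * v ^+ 2 + v - 1.
  move=> u0 uv; have le i : u ^+ i <= v ^+ i.
    by rewrite lerXn2r ?nnegrE ?(ltW uv) ?(ltW u0) ?(ltW (lt_trans u0 uv)).
  rewrite ltrD2r; apply: ler_ltD => //.
  by rewrite !lerD // ler_wpM2l // ltW.
move=> s [/andP[s0 s1] ps]; case: (ltgtP t s) => // h.
  have tp : 0 < t.
    rewrite lt_neqAle t0 andbT; apply/eqP => z.
    by move: pt; rewrite -z !expr0n /=; lra.
  by have := mono _ _ tp h; rewrite pt ps ltxx.
by have := mono _ _ s0 h; rewrite pt ps ltxx.
Qed.

Lemma beta_root_unique n k : exists! b : R, beta_root n k b.
Proof.
have g1 := @golden_gt1 R.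
have N0 : 0 <= ceil_div n k :> R.
  by rewrite ler0z ceil_ge0 (lt_le_trans _ (divr_ge0 _ _)) ?ler0n ?ltrN10.
set N : R := ceil_div n k in N0 *; have s0 : 0 <= Num.sqrt N := sqrtr_ge0 _.
pose C : R := 9 * golden ^+ 2.
have C0 : 0 < C by rewrite mulr_gt0 // exprn_gt0 //; lra.
have [||||t [ht tu]] := @quintic_root (C * N) (C * (N + 4 * Num.sqrt N))
  (C * (4 * (Num.sqrt N + 1))) (C * 4).
- by rewrite mulr_ge0 // ltW.
- by rewrite mulr_ge0 ?(ltW C0) //; lra.
- by rewrite mulr_ge0 ?(ltW C0) //; lra.
- by rewrite mulr_gt0.
exists t; split.
  by case: ht => t01 e; split=> //; rewrite -[RHS]e /C /N; ring.
by move=> s [s01 e]; apply: tu; split=> //; rewrite -[RHS]e /C /N; ring.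
Qed.

Variables (dk d2k d3k dq N lambda : R).
Hypotheses (dk01 : 0 <= dk < 1) (d2k01 : 0 <= d2k < 1) (d3k0 : 0 <= d3k).
Hypotheses (dq01 : 0 <= dq < 1) (N0 : 0 <= N).
Let r := ((3 * golden)^-1 * Num.sqrt ((1 - d2k) / (1 + dk)) - d3k)
  / (1 + Num.sqrt N * d3k).
Hypotheses (lo : (1 + dq) * (1 - r) < lambda) (hi : lambda < (1 - dq) * (1 + r)).

Let den_ge1 : 1 <= 1 + Num.sqrt N * d3k.
Proof. by rewrite lerDl mulr_ge0 ?sqrtr_ge0. Qed.

(** Since [r] is at most 1, the lower end of the window is nonnegative. *)
Lemma step_length_gt0 : 0 < lambda.
Proof.
have [/andP[k0 k1] /andP[k20 k21] /andP[q0 q1]] := And3 dk01 d2k01 dq01.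
have g1 := @golden_gt1 R; have d1 := den_ge1.
have s1 : Num.sqrt ((1 - d2k) / (1 + dk)) <= 1.
  by rewrite -[leRHS]sqrtr1 ler_wsqrtr // ler_pdivrMr; lra.
have s0 := sqrtr_ge0 ((1 - d2k) / (1 + dk)).
have c1 : (3 * golden)^-1 <= 1 :> R by rewrite invf_le1; lra.
have c0 : 0 <= (3 * golden)^-1 :> R by rewrite invr_ge0; lra.
have r1 : r <= 1.
  rewrite /r ler_pdivrMr; last lra.
  rewrite mul1r; apply: le_trans d1; rewrite lerBlDr.
  by rewrite (le_trans (mulr_ile1 c0 s0 c1 s1)) // lerDl.
apply: le_lt_trans lo; rewrite mulr_ge0 //; lra.
Qed.

(** The number [r] is the value of [DeltaL] at which the left side would equal 1, so the point is
    that [DeltaL] stays below [r]. *)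
Lemma contraction_lt1 :
  3 * golden * Num.sqrt ((1 + dk) / (1 - d2k))
    * (d3k + DeltaL lambda dq * (1 + Num.sqrt N * d3k)) < 1.
Proof.
have l0 := step_length_gt0.
have [/andP[k0 k1] /andP[k20 k21] /andP[q0 q1]] := And3 dk01 d2k01 dq01.
have g1 := @golden_gt1 R; have d1 := den_ge1.
have Dr : DeltaL lambda dq < r.
  have h1 : 1 - r < lambda / (1 + dq) by rewrite ltr_pdivlMr 1?mulrC //; lra.
  have h2 : lambda / (1 - dq) < 1 + r by rewrite ltr_pdivrMr 1?mulrC //; lra.
  (* Each end of the window bounds one quotient on one side; this ordering supplies the two missing
     sides. *)
  have h3 : lambda / (1 + dq) <= lambda / (1 - dq).
    by rewrite ler_pM2l // lef_pV2 ?posrE; lra.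
  by rewrite /DeltaL gt_max !ltr_norml; apply/andP; split; apply/andP; split; lra.
have inv : Num.sqrt ((1 + dk) / (1 - d2k)) * Num.sqrt ((1 - d2k) / (1 + dk)) = 1.
  rewrite -sqrtrM; last by rewrite divr_ge0; lra.
  have -> : (1 + dk) / (1 - d2k) * ((1 - d2k) / (1 + dk)) = 1.
    by field; apply/andP; split; lra.
  exact: sqrtr1.
have sp : 0 < Num.sqrt ((1 + dk) / (1 - d2k)).
  by rewrite sqrtr_gt0 divr_gt0; lra.
have lt : d3k + DeltaL lambda dq * (1 + Num.sqrt N * d3k)
    < (3 * golden)^-1 * Num.sqrt ((1 - d2k) / (1 + dk)).
  by move: Dr; rewrite /r ltr_pdivlMr; lra.
rewrite -(ltr_pM2l (_ : 0 < 3 * golden * Num.sqrt ((1 + dk) / (1 - d2k)))) in lt;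
  last by rewrite mulr_gt0 //; lra.
apply: lt_le_trans lt _; rewrite mulrACA inv mulfV ?mulr1 //; lra.
Qed.

End StepLength.

(** * Convergence of the iterates and the theorem *)

Lemma l2norm_contraction_cvg (R : realType) n (xs : nat -> 'cV[R]_n) (x : 'cV[R]_n) rho :
  0 <= rho < 1 ->
  (forall p, l2norm (xs p.+1 - x) <= rho * l2norm (xs p - x)) ->
  xs p @[p --> \oo] --> x.
Proof.
move=> /andP[r0 r1] step.
have geom p : l2norm (xs p - x) <= rho ^+ p * l2norm (xs 0%N - x).
  elim: p => [|p IH]; first by rewrite expr0 mul1r.
  by apply: le_trans (step p) _; rewrite exprS -mulrA ler_wpM2l.
have cv : rho ^+ p * l2norm (xs 0%N - x) @[p --> \oo] --> 0.
  rewrite -(mul0r (l2norm (xs 0%N - x))); apply: cvgMl.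
  by apply: cvg_expr; rewrite ger0_norm.
(* Convergence is meant in the sup norm of matrices, which the Euclidean norm dominates. *)
have sup_le (z : 'cV[R]_n) : `|z| <= l2norm z.
  have -> : `|z| = mx_norm z by [].
  have [->|/mx_norm_neq0[[i j] /= ->]] := eqVneq (mx_norm z) 0.
    exact: l2norm_ge0.
  by rewrite ord1 norm_le_l2norm.
apply/cvgrPdist_lt => e e0; have /cvgrPdist_lt /(_ e e0) := cv.
apply: filterS => p /=; rewrite sub0r normrN => /(le_lt_trans (ler_norm _)) h.
apply: le_lt_trans _ h; apply: le_trans (sup_le _) _.
by rewrite (l2normB x); exact: geom.
Qed.

Theorem theorem3p8 (R : realType) (m n : nat) (hmn : (m < n)%N)
  (A : 'M[R]_(m, n)) (k : nat) (hk : (0 < k)%N) (q : nat) (hq : (k <= q)%N)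
  (T : nat -> 'cV[R]_n -> {set 'I_n}) (hT : top_rule T)
  (x : 'cV[R]_n) (eta y : 'cV[R]_m) (hy : y = A *m x + eta) :
  (exists! beta : R, beta_root n k beta) /\
  forall beta : R, beta_root n k beta ->
  has_ric A (maxn q (3 * k)) -> ric A (maxn q (3 * k)) < beta ->
  forall lambda alpha gamma : R,
  (1 + ric A q) * (1 - lambda_radius A k) < lambda ->
  lambda < (1 - ric A q) * (1 + lambda_radius A k) ->
  0 < alpha -> 0 < gamma ->
  1 / (1 + ric A q) <= alpha * gamma <= 1 / (1 - ric A q) ->
  forall xs : nat -> 'cV[R]_n, CNOT T A y k q lambda alpha gamma xs ->
  let S := top_supp T k x in
  let xS := restr S x in
  let eta' := A *m restr (~: S)%SET x + eta in
  [/\ forall p, l2norm (xs p.+1 - xS) <=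
                rho3 A k q lambda * l2norm (xs p - xS)
                + tau3 A k q lambda * l2norm eta',
      rho3 A k q lambda < 1 &
      eta' = 0 -> xs p @[p --> \oo] --> xS].
Proof.
split; first exact: beta_root_unique.
move=> beta _ hric _ lambda alpha gamma lo hi _ _ ag xs [xs0 xsS] S xS eta'.
have n0 : (0 < n)%N := leq_ltn_trans (leq0n m) hmn.
have kk3 : (k <= 3 * k)%N by rewrite leq_pmull.
have k23 : (2 * k <= 3 * k)%N by rewrite leq_mul2r orbT.
have ric3 t : (t <= 3 * k)%N -> is_ric A t (ric A t).
  by move=> t3; apply/ricP/(has_ric_le _ hric); rewrite leq_max t3 orbT.
have [k01 rk _] := ric3 _ kk3.
have [k201 rk2 _] := ric3 _ k23.
have [k301 rk3 _] := ric3 _ (leqnn _).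
have [q01 rq _] := ricP (has_ric_le (leq_maxl q (3 * k)) hric).
have /andP[dk0 dk1] := k01; have /andP[d20 d21] := k201.
have /andP[d30 _] := k301; have /andP[q0 q1] := q01.
have N0 : 0 <= ceil_div n k :> R := le_trans (ler0n _ _) (ceil_div_ge hk n0).
have l0 := step_length_gt0 k01 k201 d30 q01 lo.
have rho1 : rho3 A k q lambda < 1 by exact: contraction_lt1.
have g0 : 0 < golden :> R := lt_trans ltr01 golden_gt1.
have Delta0 : 0 <= DeltaL lambda (ric A q) by rewrite /DeltaL le_max normr_ge0.
have rho0 : 0 <= rho3 A k q lambda.
  rewrite !mulr_ge0 ?sqrtr_ge0 ?(ltW g0) // addr_ge0 // mulr_ge0 //.
  by rewrite addr_ge0 // mulr_ge0 ?sqrtr_ge0.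
(* A feasible weight exists: n entries, each at most 1, have sum k. *)
have kn : (k <= n)%N.
  have [w [[[ws w01] _] _]] := xsS 0%N.
  rewrite -(ler_nat R) -ws -[n in leRHS]card_ord -sumr_const.
  by apply: ler_sum => i _; case/andP: (w01 i).
have hyS : y = A *m xS + eta' by rewrite hy addrA -mulmxDr restrC.
(* [S] may have fewer than k elements; [T k x] has exactly k and serves as the k-set containing
   it. *)
have suppxS : supp xS \subset T k x.
  by apply: fintype.subset_trans (supp_restr _ _) (supp_restr _ _).
have xsk p : (#|supp (xs p)| <= k)%N.
  case: p => [|p]; last first.
    by have [w [_ ->]] := xsS p; exact: card_top_supp.
  by rewrite xs0 eq_card0 // => i; rewrite !inE mxE eqxx.
have step p : l2norm (xs p.+1 - xS) <=
    rho3 A k q lambda * l2norm (xs p - xS) + tau3 A k q lambda * l2norm eta'.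
  have [w [wopt ->]] := xsS p.
  have Tk : #|T k x| = k by rewrite (hT k x).1 (minn_idPl kn).
  have xSk : (#|supp xS| <= k)%N by rewrite -Tk subset_leq_card.
  have err K := newton_error hT hk n0 dk0 rk d30 rk3 q01 rq (ltW l0) ag
    (xsk p) xSk hyS (K := K).
  apply: le_trans (thresholding_error hT dk0 rk d21 rk2 kn suppxS Tk hyS wopt err) _.
  rewrite /rho3 /tau3 sqrtrM ?addr_ge0 // sqrtrV ?subr_ge0 ?(ltW d21) //.
  set s := Num.sqrt (1 - _); set c := Num.sqrt (1 + _).
  set a := l2norm (xs p - xS); set e := l2norm eta'.
  set D := ric A (3 * k) + _; set N := Num.sqrt (ceil_div n k).
  have s0 : 0 < s by rewrite sqrtr_gt0 subr_gt0.
  have c0 : 0 <= c := sqrtr_ge0 _.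
  have D0 : 0 <= D by rewrite addr_ge0 // mulr_ge0 // addr_ge0 // mulr_ge0 ?sqrtr_ge0.
  have c2 : c * c = 1 + ric A k by rewrite -expr2 sqr_sqrtr // addr_ge0.
  rewrite -c2 -subr_ge0.
  (* The slack is one third of the [rho3] term plus one third of the first part of the [tau3] term,
     since the step estimate has 2 where these have 3. *)
  set rhs := (X in 0 <= X).
  have -> : rhs = golden / s * (c * (D * a + lambda / (1 - ric A q) * (N * (c * e)))).
    by rewrite /rhs; field; apply/andP; split; rewrite ?gt_eqF ?subr_gt0.
  rewrite mulr_ge0 ?divr_ge0 ?(ltW g0) ?(ltW s0) // mulr_ge0 // addr_ge0 //.
    by rewrite mulr_ge0 ?l2norm_ge0.
  by rewrite mulr_ge0 ?divr_ge0 ?subr_ge0 ?(ltW l0) ?(ltW q1) // !mulr_ge0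
    ?sqrtr_ge0 ?l2norm_ge0.
split=> // eta0; apply: (@l2norm_contraction_cvg _ _ _ _ (rho3 A k q lambda)).
  by rewrite rho0.
by move=> p; have := step p; rewrite eta0 l2norm0 mulr0 addr0.
Qed.
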